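(* Let $\mathcal{A}$ be a commutative $C^*$-algebra with unit $e$, and let $a\in\mathcal{A}$. 1. If $a$ is self-adjoint, then $\sigma(a)\subset\mathbb{R}$. 2. If $a$ is unitary, then $\sigma(a)\subset S^1$. 3. If $a$ is a projection, then $\sigma(a)\subset\{0,1\}$. 4. If $a$ is positive, then $\sigma(a)\subset\mathbb{R}^+\cup\{0\}$.
   Context: All algebras are over $\mathbb{C}$. A $C^*$-algebra is a Banach algebra $(\mathcal{A},\|\cdot\|)$ with an involution $*$ (conjugate-linear, $(a^* )^*=a$, $(ab)^*=b^*a^*$) such that $\|a^*a\|=\|a\|^2$ for all $a$. The spectrum of $a$ is $\sigma(a)=\{\lambda\in\mathbb{C} : \lambda e-a \text{ is not invertible in } \mathcal{A}\}$. $S^1$ is the unit circle in $\mathbb{C}$ and $\mathbb{R}^+$ the set of positive real numbers. An element $a\in\mathcal{A}$ is self-adjoint if $a=a^*$; unitary if $aa^*=a^*a=e$; a projection if $a^*=a$ and $a^2=a$; positive if $a=bb^*$ for some $b\in\mathcal{A}$. *)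

(* Defs.v *)
From HB Require Import structures.
From mathcomp Require Import all_boot all_order all_algebra.
From mathcomp Require Import all_classical all_reals all_analysis.
From mathcomp Require Export complex.

Set Implicit Arguments.
Unset Strict Implicit.
Unset Printing Implicit Defensive.

Import Order.TTheory GRing.Theory Num.Theory.
Import numFieldNormedType.Exports.

Local Open Scope classical_set_scope.
Local Open Scope ring_scope.

(* A Banach algebra with unit over K, on top of the library's complete normed
   modules.  The product is a field of the mixin rather than that of a
   [pzRingType], because a second structure with both a ring product and a norm
   has no consistent join with the existing [numDomainType].  The zero algebra
   is allowed.
   The norm of a [normedModType K] takes its values in K; for K = R[i], a norm
   is a nonnegative element of R[i], that is, a nonnegative real number. *)
HB.mixin Record isBanachAlgebra (K : numFieldType) A
    of CompleteNormedModule K A := {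
  amul : A -> A -> A ;
  aone : A ;
  amulA : associative amul ;
  amul1l : left_id aone amul ;
  amul1r : right_id aone amul ;
  amulDl : left_distributive amul +%R ;
  amulDr : right_distributive amul +%R ;
  ascaleAl : forall (k : K) (x y : A), k *: amul x y = amul (k *: x) y ;
  ascaleAr : forall (k : K) (x y : A), k *: amul x y = amul x (k *: y) ;
  norm_amul_le : forall x y : A, `|amul x y| <= `|x| * `|y|
}.

#[short(type="banachAlgType")]
HB.structure Definition BanachAlgebra (K : numFieldType) :=
  {A of CompleteNormedModule K A & isBanachAlgebra K A}.

HB.mixin Record isCStarAlgebra (R : realType) A of BanachAlgebra R[i] A := {
  star : A -> A ;
  starD : forall x y : A, star (x + y) = star x + star y ;
  starZ : forall (k : R[i]) (x : A), star (k *: x) = k^* *: star x ;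
  starK : involutive star ;
  starM : forall x y : A, star (amul x y) = amul (star y) (star x) ;
  norm_star_mul : forall x : A, `|amul (star x) x| = `|x| ^+ 2
}.

#[short(type="cstarAlgType")]
HB.structure Definition CStarAlgebra (R : realType) :=
  {A of BanachAlgebra R[i] A & isCStarAlgebra R A}.

HB.mixin Record isComCStarAlgebra (R : realType) A of CStarAlgebra R A := {
  amulC : commutative (amul : A -> A -> A)
}.

#[short(type="comCStarAlgType")]
HB.structure Definition ComCStarAlgebra (R : realType) :=
  {A of CStarAlgebra R A & isComCStarAlgebra R A}.

Definition invertible (K : numFieldType) (A : banachAlgType K) (x : A) : Prop :=
  exists y : A, amul x y = aone /\ amul y x = aone.

Definition spectrum (K : numFieldType) (A : banachAlgType K) (a : A) : set K :=
  [set l : K | ~ invertible (l *: aone - a)].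

Section Elements.
Context (R : realType) (A : cstarAlgType R).
Implicit Type a : A.

Definition self_adjoint a : Prop := a = star a.

Definition unitary a : Prop := amul a (star a) = aone /\ amul (star a) a = aone.

Definition projection a : Prop := star a = a /\ amul a a = a.

Definition positive a : Prop := exists b : A, a = amul b (star b).

End Elements.

Definition real_line (R : realType) : set R[i] := [set x%:C%C | x in [set: R]].

Definition unit_circle (R : realType) : set R[i] := [set z | `|z| = 1].

Definition pos_reals (R : realType) : set R[i] :=
  [set x%:C%C | x in [set x : R | 0 < x]].

Arguments real_line R : clear implicits.
Arguments unit_circle R : clear implicits.
Arguments pos_reals R : clear implicits.

(* Main.v *)
Require Import Defs.
From mathcomp Require Import all_boot all_order all_algebra.
From mathcomp Require Import all_classical all_reals all_analysis.
From mathcomp Require Import ring lra.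


(** The classical proof goes through the Gelfand transform.  The one below is
    elementary: the only link between spectrum and norm that it uses is
    [spectrum_norm_le], that the spectrum of [x] lies in the disc of radius
    [|x|], which is the Neumann series.  The trick is always to apply this bound
    to an element built from [a], whose spectrum is known from that of [a].

    - If [a] is self-adjoint, every [a + i t] with [t] real has norm at most
      [sqrt (|a|^2 + t^2)] by the C*-identity, while [l] in the spectrum of [a]
      gives [l + i t] in that of [a + i t].  Hence
      [(Im l + t)^2 <= |a|^2 + t^2] for all real [t], and [Im l = 0].
    - If [a] is unitary, then [a] and [star a = a^-1] have norm at most [1], and
      [l^-1] is in the spectrum of [a^-1].
    - If [a] is idempotent, [(l - a) (l - 1 + a) = l (l - 1)].
    - If [a = b (star b)], write [b = x + i y] with [x], [y] self-adjoint, so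
      that [a = x^2 + y^2] by commutativity.  For self-adjoint [x] and small
      [r > 0], [|1 - r x^2|] exceeds [1] by [O(r^2)] only
      ([rnorm_aoneB_sqr_le]), because [1 - r x^2] is the real part of the almost
      unitary element [1 - r x^2 + i sqrt (2 r) x].  Averaging over [x] and [y],
      [|1 - r a| <= 1 + O(r^2)].  A point [l < 0] of the spectrum would force
      [1 - r l <= 1 + O(r^2)], which fails for small [r]. *)

Import Order.TTheory GRing.Theory Num.Theory.
Import numFieldNormedType.Exports.

Local Open Scope classical_set_scope.
Local Open Scope ring_scope.

(** * Products, invertibility and spectra in a Banach algebra *)

Section BanachAlgebra.
Context {K : numFieldType} {A : banachAlgType K}.
Implicit Types (x y : A) (k : K).

Local Notation "x ** y" := (amul x y) (at level 40, left associativity).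

Lemma amulNl x y : (- x) ** y = - (x ** y).
Proof. by rewrite -[- x]scaleN1r -ascaleAl scaleN1r. Qed.

Lemma amulNr x y : x ** (- y) = - (x ** y).
Proof. by rewrite -[- y]scaleN1r -ascaleAr scaleN1r. Qed.

Lemma amulBl x y z : (x - y) ** z = x ** z - y ** z.
Proof. by rewrite amulDl amulNl. Qed.

Lemma amulBr x y z : x ** (y - z) = x ** y - x ** z.
Proof. by rewrite amulDr amulNr. Qed.

Lemma amulr0 x : x ** 0 = 0.
Proof. by rewrite -{1}(subrr x) amulBr subrr. Qed.

Lemma amul0r x : 0 ** x = 0.
Proof. by rewrite -{1}(subrr x) amulBl subrr. Qed.

Lemma invertibleM x y : invertible x -> invertible y -> invertible (x ** y).
Proof.
move=> [u [xu ux]] [v [yv vy]]; exists (v ** u); split.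
- by rewrite amulA -(amulA x) yv amul1r.
- by rewrite amulA -(amulA v) ux amul1r.
Qed.

Lemma invertibleZ k x : k != 0 -> invertible x -> invertible (k *: x).
Proof.
move=> k0 [u [xu ux]]; exists (k^-1 *: u).
by rewrite -!ascaleAl -!ascaleAr xu ux !scalerA mulfV// mulVf// scale1r.
Qed.

(** Since [(c + d l) 1 - (c 1 + d x) = d (l 1 - x)]. *)
Lemma spectrum_affine (c d : K) (l : K) x : d != 0 ->
  spectrum x l -> spectrum (c *: aone + d *: x) (c + d * l).
Proof.
move=> d0 xl inv; apply: xl.
suff -> : l *: aone - x
    = d^-1 *: ((c + d * l) *: aone - (c *: aone + d *: x)).
  by apply: invertibleZ => //; rewrite invr_eq0.
by rewrite scalerDl -scalerA opprD addrACA subrr add0r -scalerBr scalerA mulVf// scale1r.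
Qed.

(** Since [l - x = - l (l^-1 - y) x]. *)
Lemma spectrum_inv (l : K) x y :
  x ** y = aone -> y ** x = aone -> spectrum x l -> l != 0 /\ spectrum y l^-1.
Proof.
move=> xy yx xl; have ix : invertible x by exists y.
have l0 : l != 0.
  apply/eqP => l0; apply: xl; rewrite l0 scale0r sub0r -scaleN1r.
  by apply: invertibleZ => //; rewrite oppr_eq0 oner_eq0.
split=> // iy; apply: xl.
have -> : l *: aone - x = (- l) *: ((l^-1 *: aone - y) ** x).
  rewrite amulBl yx -ascaleAl amul1l scalerBr scalerA mulNr mulfV// scaleN1r.
  by rewrite scaleNr opprK addrC.
by apply: invertibleZ; [rewrite oppr_eq0|exact: invertibleM].
Qed.

Lemma cvg_amull x (u : nat -> A) (l : A) :
  u n @[n --> \oo] --> l -> x ** u n @[n --> \oo] --> x ** l.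
Proof.
move=> ul.
have x1 : 0 < `|x| + 1 by apply: ltr_wpDl.
apply/cvgrPdist_lt => e e0; near=> n.
rewrite -amulBr (le_lt_trans (norm_amul_le _ _))//.
rewrite (@le_lt_trans _ _ ((`|x| + 1) * `|l - u n|))//.
  by rewrite ler_wpM2r// lerDl.
rewrite -ltr_pdivlMl//; near: n.
by move/cvgrPdist_lt : ul; apply; rewrite mulr_gt0// invr_gt0.
Unshelve. all: by end_near. Qed.

Lemma cvg_amulr x (u : nat -> A) (l : A) :
  u n @[n --> \oo] --> l -> u n ** x @[n --> \oo] --> l ** x.
Proof.
move=> ul.
have x1 : 0 < `|x| + 1 by apply: ltr_wpDl.
apply/cvgrPdist_lt => e e0; near=> n.
rewrite -amulBl (le_lt_trans (norm_amul_le _ _))//.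
rewrite (@le_lt_trans _ _ (`|l - u n| * (`|x| + 1)))//.
  by rewrite ler_wpM2l// lerDl.
rewrite -ltr_pdivlMr//; near: n.
by move/cvgrPdist_lt : ul; apply; rewrite mulr_gt0// invr_gt0.
Unshelve. all: by end_near. Qed.

End BanachAlgebra.

Local Notation "x ** y" := (amul x y) (at level 40, left associativity).

(** * The Neumann series over the complex numbers *)

Section Neumann.
Context {R : realType} {A : banachAlgType R[i]}.
Implicit Types x y : A.

(** The norm takes values in the partially ordered field [R[i]]; estimates are
    carried out in the ordered field [R], on its real part, which by [rnormE]
    determines it. *)
Definition rnorm x : R := complex.Re `|x|.

Lemma rnormE x : `|x| = (rnorm x)%:C%C.
Proof. by rewrite /rnorm RRe_real// normr_real. Qed.

Lemma rnorm_ge0 x : 0 <= rnorm x.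
Proof. by rewrite -ler0c -rnormE. Qed.

Lemma rnormD x y : rnorm (x + y) <= rnorm x + rnorm y.
Proof. by rewrite -lecR rmorphD/= -!rnormE ler_normD. Qed.

Lemma rnormM x y : rnorm (x ** y) <= rnorm x * rnorm y.
Proof. by rewrite -lecR rmorphM/= -!rnormE norm_amul_le. Qed.

Lemma rnormZ (r : R) x : 0 <= r -> rnorm (r%:C%C *: x) = r * rnorm x.
Proof.
move=> r0; apply: complexI; rewrite rmorphM/= -!rnormE normrZ ger0_norm//.
by rewrite ler0c.
Qed.

Lemma expr_mul_lt (q B e : R) : 0 <= q < 1 -> 0 < e -> exists n, q ^+ n * B < e.
Proof.
move=> /andP[q0 q1] e0.
have : geometric B q @ \oo --> 0 by apply: cvg_geometric; rewrite ger0_norm.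
move=> /cvgrPdist_lt/(_ _ e0)[n _ /(_ n (leqnn n))]; rewrite sub0r normrN /= => h.
by exists n; rewrite mulrC (le_lt_trans (ler_norm _)).
Qed.

(** The partial sum [1 + x + ... + x^(n-1)], in Horner form: estimates and the
    fixed point equation of the limit then follow from one step of the
    recursion. *)
Fixpoint neumann x n : A := if n is m.+1 then aone + x ** neumann x m else 0.

Lemma neumann_comm x n : x ** neumann x n = neumann x n ** x.
Proof.
elim: n => [|n ih] /=; first by rewrite amulr0 amul0r.
by rewrite amulDr amulDl amul1l amul1r ih amulA ih.
Qed.

(** The bound is the fixed point of [t |-> |1| + |x| t]. *)
Lemma neumann_bound x n :
  rnorm x < 1 -> rnorm (neumann x n) <= rnorm (aone : A) / (1 - rnorm x).
Proof.
move=> x1; have d0 : 0 < 1 - rnorm x by rewrite subr_gt0.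
elim: n => [|n ih] /=.
  by rewrite /rnorm normr0 divr_ge0 ?rnorm_ge0 ?ltW.
rewrite (le_trans (rnormD _ _))// (le_trans (lerD (lexx _) (rnormM _ _)))//.
rewrite (le_trans (lerD (lexx _) (ler_wpM2l (rnorm_ge0 x) ih)))//.
by rewrite le_eqVlt; apply/orP; left; apply/eqP; field; rewrite gt_eqF.
Qed.

Lemma neumann_tail x n m : rnorm x < 1 ->
  rnorm (neumann x n - neumann x (n + m)) <=
  rnorm x ^+ n * (rnorm (aone : A) / (1 - rnorm x)).
Proof.
move=> x1; elim: n => [|n ih].
  rewrite add0n /= sub0r mul1r {1}/rnorm normrN; exact: neumann_bound.
rewrite addSn /= opprD addrACA subrr add0r -amulBr (le_trans (rnormM _ _))//.
by rewrite exprS -mulrA ler_wpM2l// rnorm_ge0.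
Qed.

Lemma neumann_cvg x : rnorm x < 1 -> cvg (neumann x n @[n --> \oo]).
Proof.
move=> x1; apply: cauchy_cvg; apply: cauchy_exP => e e0.
have eE : e = (complex.Re e)%:C%C by rewrite RRe_real// gtr0_real.
have [n hn] : exists n,
    rnorm x ^+ n * (rnorm (aone : A) / (1 - rnorm x)) < complex.Re e.
  by apply: expr_mul_lt; rewrite ?rnorm_ge0// -ltcR -eE.
exists (neumann x n), n => //= m /= nm.
rewrite -ball_normE /= rnormE eE ltcR (le_lt_trans _ hn)//.
by rewrite -(subnKC nm) neumann_tail.
Qed.

(** The limit [s] of the Neumann series satisfies [s = 1 + x s] and commutes
    with [x]. *)
Lemma invertible_aoneB x : rnorm x < 1 -> invertible (aone - x).
Proof.
move=> /neumann_cvg cs; set s := lim (neumann x n @[n --> \oo]) in cs.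
have hs : neumann x n @[n --> \oo] --> s by [].
have xs : x ** s = s ** x.
  apply: (cvg_unique (norm_hausdorff (V := A))
    (F := x ** neumann x n @[n --> \oo])); first exact: cvg_amull.
  rewrite /=; under eq_fun do rewrite neumann_comm.
  exact: cvg_amulr.
have sE : s = aone + x ** s.
  apply: (cvg_unique (norm_hausdorff (V := A)) (F := neumann x n.+1 @[n --> \oo])).
    by move: hs; rewrite -(cvg_shiftS (neumann x)).
  by apply: cvgD; [exact: cvg_cst|exact: cvg_amull].
exists s; rewrite amulBl amulBr amul1l amul1r -xs.
by split; rewrite [X in X - _]sE addrK.
Qed.

(** If [|x| < |l|], then [l - x = l (1 - l^-1 x)] is invertible. *)
Lemma spectrum_norm_le x l : spectrum x l -> `|l| <= `|x|.
Proof.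
move=> xl; rewrite real_leNgt ?normr_real//; apply/negP => lx; apply: xl.
have l0 : l != 0 by rewrite -normr_gt0 (le_lt_trans _ lx).
have -> : l *: aone - x = l *: (aone - l^-1 *: x).
  by rewrite scalerBr scalerA mulfV// scale1r.
apply: invertibleZ => //; apply: invertible_aoneB.
rewrite -ltcR -rnormE normrZ normfV mulrC ltr_pdivrMr ?normr_gt0//.
by rewrite mul1r.
Qed.

End Neumann.

(** * Self-adjoint elements of a C*-algebra *)

Section CStarAlgebra.
Context {R : realType} {A : cstarAlgType R}.
Implicit Types (x y a b : A) (r t : R).

Lemma star1 : star (aone : A) = aone.
Proof. by rewrite -[LHS]amul1l -[X in X ** _]starK -starM amul1l starK. Qed.

Lemma starN x : star (- x) = - star x.
Proof. by rewrite -scaleN1r starZ rmorphN1 scaleN1r. Qed.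

Lemma starZr r x : star (r%:C%C *: x) = r%:C%C *: star x.
Proof. by rewrite starZ conj_Creal//; apply/complex_realP; exists r. Qed.

Lemma starZi x : star ('i%C *: x) = - ('i%C *: star x).
Proof. by rewrite starZ conjCi scaleNr. Qed.

Lemma self_adjointZr r x : self_adjoint x -> self_adjoint (r%:C%C *: x).
Proof. by rewrite /self_adjoint starZr => <-. Qed.

Lemma self_adjoint_mul x y : self_adjoint x -> self_adjoint y ->
  x ** y = y ** x -> self_adjoint (x ** y).
Proof. by rewrite /self_adjoint starM => <- <-. Qed.

Lemma rnorm_star_mul x : rnorm (star x ** x) = rnorm x ^+ 2.
Proof. by apply: complexI; rewrite rmorphXn/= -!rnormE norm_star_mul. Qed.

(** An inequality only: in the zero algebra this norm is [0]. *)
Lemma rnorm_aone_le1 : rnorm (aone : A) <= 1.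
Proof.
have := rnorm_star_mul aone; rewrite star1 amul1l => h.
have := rnorm_ge0 (aone : A); nra.
Qed.

(** From [|x|^2 = |star x x| <= |star x| |x|], applied to [x] and [star x]. *)
Lemma rnorm_star x : rnorm (star x) = rnorm x.
Proof.
suff le y : rnorm y <= rnorm (star y).
  by apply/eqP; rewrite eq_le le andbT -[X in _ <= rnorm X]starK le.
have := rnormM (star y) y; rewrite rnorm_star_mul.
have := rnorm_ge0 y; have := rnorm_ge0 (star y); nra.
Qed.

Lemma star_mul_cartesian x y : self_adjoint x -> self_adjoint y ->
  x ** y = y ** x ->
  star (x + 'i%C *: y) ** (x + 'i%C *: y) = x ** x + y ** y.
Proof.
move=> sx sy xy; rewrite starD starZi -sx -sy amulBl !amulDr -!ascaleAl -!ascaleAr.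
rewrite scalerA -expr2 sqr_i scaleN1r xy opprD opprK.
by rewrite addrA addrK.
Qed.

Lemma rnorm_cartesian x y : self_adjoint x -> self_adjoint y ->
  x ** y = y ** x -> rnorm (x + 'i%C *: y) ^+ 2 = rnorm (x ** x + y ** y).
Proof. by move=> sx sy xy; rewrite -rnorm_star_mul star_mul_cartesian. Qed.

(** The real part [x = (v + star v) / 2] of [v = x + i y] has norm at most
    [|v|]. *)
Lemma rnorm_sqr_le x y : self_adjoint x -> self_adjoint y ->
  x ** y = y ** x -> rnorm x ^+ 2 <= rnorm (x ** x + y ** y).
Proof.
move=> sx sy xy; rewrite -rnorm_cartesian//; set v := x + _.
rewrite lerXn2r ?nnegrE ?rnorm_ge0//.
have v2 : (2 : R)%:C%C *: x = v + star v.
  rewrite /v starD starZi -sx -sy addrACA subrr addr0.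
  by rewrite rmorphD/= scalerDl scale1r.
have := rnormD v (star v); rewrite -v2 rnormZ// rnorm_star; lra.
Qed.

Lemma spectrum_sqr_le x (l : R[i]) : spectrum x l ->
  complex.Re l ^+ 2 + complex.Im l ^+ 2 <= rnorm x ^+ 2.
Proof.
move=> /spectrum_norm_le lx; rewrite -lecR add_Re2_Im2 rmorphXn/= -rnormE.
by rewrite lerXn2r ?nnegrE.
Qed.

(** Arens' trick: translate by [i t], compare squared norms, and let [t] have
    the sign of [Im l] and grow, so that the cross term [2 (Im l) t] wins. *)
Lemma spectrum_self_adjoint x (l : R[i]) :
  self_adjoint x -> spectrum x l -> complex.Im l = 0.
Proof.
move=> sx xl.
have key t : (complex.Im l + t) ^+ 2 <= rnorm x ^+ 2 + t ^+ 2.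
  have /spectrum_sqr_le : spectrum ('i%C *: (t%:C%C *: aone) + 1 *: x)
      ('i%C * t%:C%C + 1 * l).
    by rewrite scalerA; apply: spectrum_affine => //; exact: oner_neq0.
  have s1 : self_adjoint (aone : A) by rewrite /self_adjoint star1.
  rewrite scale1r mul1r [X in rnorm X]addrC rnorm_cartesian//; last 2 first.
  - exact: self_adjointZr.
  - by rewrite -ascaleAl -ascaleAr amul1l amul1r.
  rewrite -ascaleAl -ascaleAr amul1l scalerA -rmorphM/=.
  move: l {xl} => [a b] /=; rewrite !mul0r !mul1r !add0r ?subr0 ?oppr0 => h.
  have := rnormD (x ** x) ((t * t)%:C%C *: aone); rewrite rnormZ -?expr2 ?sqr_ge0//.
  have := rnormM x x; have := rnorm_aone_le1; have := sqr_ge0 t.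
  have := sqr_ge0 a; rewrite -expr2 [b + t]addrC; nra.
apply/eqP/negPn/negP => b0; set b := complex.Im l in key b0.
(* This value of [t] makes the cross term exceed [|x|^2]. *)
have := key ((rnorm x ^+ 2 + 1) / (2 * b)).
set t := _ / _; have bt : 2 * b * t = rnorm x ^+ 2 + 1.
  by rewrite /t; field.
have := sqr_ge0 b; nra.
Qed.

Lemma cartesianP b : exists x y : A,
  [/\ self_adjoint x, self_adjoint y & b = x + 'i%C *: y].
Proof.
exists (2^-1%:C%C *: (b + star b)), (2^-1%:C%C *: ('i%C *: (star b - b))); split.
- by apply: self_adjointZr; rewrite /self_adjoint starD starK addrC.
- apply: self_adjointZr.
  by rewrite /self_adjoint starZi starD starN starK -scalerN opprB.
- rewrite !scalerA mulrAC -expr2 sqr_i mulN1r scaleNr -scalerBr opprB.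
  rewrite addrACA subrr addr0 -[b in RHS]scale1r -scalerDl scalerA.
  by rewrite -(rmorphD (real_complex R)) -rmorphM/= mulVf ?rmorph1 ?scale1r.
Qed.

(** Take [u = 1 - r x^2] and [v = sqrt (2 r) x]: then [u^2 + v^2 = 1 + r^2 x^4],
    the linear terms in [r] cancelling, and [|u|^2 <= |u^2 + v^2|]. *)
Lemma rnorm_aoneB_sqr_le r x : 0 <= r -> self_adjoint x ->
  rnorm (aone - r%:C%C *: (x ** x)) ^+ 2 <= 1 + r ^+ 2 * rnorm x ^+ 4.
Proof.
move=> r0 sx; set u := aone - _.
pose v := (Num.sqrt (2 * r))%:C%C *: x.
have sv : self_adjoint v by exact: self_adjointZr.
have su : self_adjoint u.
  rewrite /self_adjoint /u starD starN star1; congr (_ - _).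
  by apply: self_adjointZr; exact: self_adjoint_mul.
have uv : u ** v = v ** u.
  rewrite /u /v amulBl amulBr amul1l amul1r -!ascaleAl -!ascaleAr.
  by rewrite !scalerA (mulrC r%:C%C) amulA.
have uvE : u ** u + v ** v = aone + (r ^+ 2)%:C%C *: (x ** x ** (x ** x)).
  rewrite /u /v amulBl !amulBr amul1l amul1r amul1l -!ascaleAl -!ascaleAr.
  have cc : r%:C%C * r%:C%C = (r ^+ 2)%:C%C :> R[i] by rewrite -rmorphM expr2.
  have ss : (Num.sqrt (2 * r))%:C%C * (Num.sqrt (2 * r))%:C%C
      = r%:C%C + r%:C%C :> R[i].
    rewrite -rmorphM -expr2 sqr_sqrtr ?mulr_ge0// -rmorphD.
    by rewrite mulr_natl mulr2n.
  rewrite !scalerA cc ss scalerDl; set w := r%:C%C *: _; set z := _ *: _.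
  by rewrite opprB addrACA !subrK.
rewrite (le_trans (rnorm_sqr_le _ _ su sv uv))// uvE (le_trans (rnormD _ _))//.
rewrite rnormZ ?sqr_ge0// lerD ?rnorm_aone_le1// ler_wpM2l ?sqr_ge0//.
have := rnormM (x ** x) (x ** x); have := rnormM x x.
have := rnorm_ge0 x; have := rnorm_ge0 (x ** x); nra.
Qed.

(** * Spectra of the special elements *)

(** A negative [l] in the spectrum gives, for small [r > 0], the bounds
    [1 - 2 r l <= (1 - r l)^2 <= 1 + O(r^2)], the second one because
    [1 - r (x^2 + y^2)] is the mean of [1 - 2 r x^2] and [1 - 2 r y^2]. *)
Lemma spectrum_sum_sqr_ge0 x y (l : R) : self_adjoint x -> self_adjoint y ->
  spectrum (x ** x + y ** y) l%:C%C -> 0 <= l.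
Proof.
move=> sx sy xyl; rewrite leNgt; apply/negP => l0.
set M := rnorm x ^+ 4 + rnorm y ^+ 4.
have x4 : 0 <= rnorm x ^+ 4 by rewrite exprn_ge0// rnorm_ge0.
have y4 : 0 <= rnorm y ^+ 4 by rewrite exprn_ge0// rnorm_ge0.
have key (r : R) : 0 < r -> (1 - r * l) ^+ 2 <= 1 + 2 * r ^+ 2 * M.
  move=> r0.
  have /spectrum_sqr_le : spectrum (1 *: aone + (- r%:C%C) *: (x ** x + y ** y))
      (1 + (- r%:C%C) * l%:C%C).
    apply: spectrum_affine => //; rewrite oppr_eq0.
    by rewrite fmorph_eq0 gt_eqF.
  have -> : 1 *: aone + (- r%:C%C) *: (x ** x + y ** y) = (2^-1 : R)%:C%C *:
      ((aone - (2 * r)%:C%C *: (x ** x)) + (aone - (2 * r)%:C%C *: (y ** y))).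
    rewrite addrACA -opprD -scalerDr scalerBr scalerA -rmorphM/= mulrA mulVf// mul1r.
    rewrite scale1r scaleNr; congr (_ - _).
    rewrite scalerDr -scalerDl -rmorphD/=.
    by have -> : 2^-1 + 2^-1 = 1 :> R by [lra]; rewrite scale1r.
  rewrite mulNr -rmorphM -(rmorph1 (real_complex R)) -rmorphB/= rnormZ ?invr_ge0//.
  rewrite expr0n addr0.
  have r20 : 0 <= 2 * r by lra.
  have := rnorm_aoneB_sqr_le _ _ r20 sx; have := rnorm_aoneB_sqr_le _ _ r20 sy.
  set p := aone - _; set q := aone - _.
  have := rnormD q p; have := rnorm_ge0 (q + p).
  set P := rnorm p; set Q := rnorm q; set N := rnorm (q + p).
  rewrite /M => N0 NPQ hP hQ hN.
  have : N ^+ 2 <= (Q + P) ^+ 2 by rewrite lerXn2r// nnegrE (le_trans N0).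
  have := sqr_ge0 (P - Q); nra.
have M0 : 0 <= M by exact: addr_ge0.
(* The estimate fails as soon as [r M < - l]; adding [1] covers [M = 0]. *)
have r0 : 0 < - l / (M + 1) by rewrite divr_gt0 ?oppr_gt0// ltr_wpDl.
have := key _ r0; set r := _ / _ in r0 *.
have rE : r * M + r = - l by rewrite /r; field; rewrite gt_eqF// ltr_wpDl.
nra.
Qed.

Lemma spectrum_unitary a (l : R[i]) : unitary a -> spectrum a l -> `|l| = 1.
Proof.
move=> [aas asa] al.
have le1 (u : A) m : rnorm u ^+ 2 <= 1 -> spectrum u m -> `|m| <= 1.
  move=> u1 /spectrum_norm_le/le_trans; apply.
  rewrite rnormE -(rmorph1 (real_complex R)) lecR.
  by rewrite -(@expr_le1 _ 2) ?rnorm_ge0.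
have a1 : rnorm a ^+ 2 <= 1 by rewrite -rnorm_star_mul asa rnorm_aone_le1.
have [l0 sl] := spectrum_inv _ _ _ aas asa al.
apply/eqP; rewrite eq_le (le1 _ _ a1 al)/=.
have /le1/(_ sl) : rnorm (star a) ^+ 2 <= 1 by rewrite rnorm_star.
by rewrite normfV invf_le1// normr_gt0.
Qed.

Lemma spectrum_idempotent a (l : R[i]) :
  a ** a = a -> spectrum a l -> l = 0 \/ l = 1.
Proof.
move=> aa al; have [->|l0] := eqVneq l 0; first by left.
have [->|l1] := eqVneq l 1; [by right|exfalso; apply: al].
have ll : l * (l - 1) != 0 by rewrite mulf_neq0// subr_eq0.
pose c := (l - 1) *: aone + a.
have la : (l - 1) *: a + a = l *: a by rewrite scalerBl scale1r subrK.
have lc : (l *: aone - a) ** c = (l * (l - 1)) *: aone.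
  rewrite /c amulBl !amulDr -!ascaleAl -!ascaleAr !amul1l amul1r aa scalerA.
  by rewrite la addrK.
have cl : c ** (l *: aone - a) = (l * (l - 1)) *: aone.
  rewrite /c amulDl !amulBr -!ascaleAl -!ascaleAr !amul1l amul1r aa scalerA.
  by rewrite -la addrK subrK mulrC.
exists ((l * (l - 1))^-1 *: c).
by rewrite -ascaleAr -ascaleAl lc cl scalerA mulVf// scale1r.
Qed.

End CStarAlgebra.

Theorem theorem6p5 (R : realType) (A : comCStarAlgType R) (a : A) :
  [/\ self_adjoint a -> spectrum a `<=` real_line R,
      unitary a -> spectrum a `<=` unit_circle R,
      projection a -> spectrum a `<=` [set 0; 1]
    & positive a -> spectrum a `<=` pos_reals R `|` [set 0]].
Proof.
have real_of (c : A) l : self_adjoint c -> spectrum c l -> l = (complex.Re l)%:C%C.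
  by move=> sc /(spectrum_self_adjoint _ _ sc); case: l => u v /= ->.
split.
- by move=> sa l /(real_of _ _ sa) lE; exists (complex.Re l).
- by move=> ua l; exact: spectrum_unitary.
- by move=> [_ aa] l; exact: spectrum_idempotent.
- move=> [b ->] l bl.
  have sbb : self_adjoint (b ** star b) by rewrite /self_adjoint starM starK.
  have lE := real_of _ _ sbb bl.
  have [x [y [sx sy bE]]] := cartesianP b.
  move: bl; rewrite amulC bE star_mul_cartesian//; last exact: amulC.
  rewrite lE => /(spectrum_sum_sqr_ge0 _ _ _ sx sy).
  rewrite le_eqVlt => /predU1P[<-|l0]; first by right.
  by left; exists (complex.Re l).
Qed.
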